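(* Let $(S,\Sigma,\delta)$ be an HMM with $\epsilon$-transitions such that from each state there is an outgoing path of non-zero probability containing a symbol in $\Sigma$, and let $a\in\Sigma$. For $s_0,s\in S$ let $\mathcal{E}^a_{s_0,s}$ denote the probability of the most likely path in $\Omega^1_{s_0}$ that starts in $s_0$, ends in $s$ and has observation $a$, i.e. $$\mathcal{E}^a_{s_0,s}=\max_{\widetilde{z}\in\Omega^1_{s_0},\ L(\widetilde{z})=s}P(Z=\widetilde{z}\land Y=a).$$ Then for all $s_0,s\in S$ $$\mathcal{E}^a_{s_0,s}=\max\Big(\delta(s_0)(a,s),\ \max_{s'\in S}\delta(s_0)(\epsilon,s')\cdot\mathcal{E}^a_{s',s}\Big).$$
   Context: An HMM with $\epsilon$-transitions is a triple $(S,\Sigma,\delta)$ with a finite state space $S$, an alphabet $\Sigma$ (a finite set of observable symbols, with $\epsilon\notin\Sigma$) and a transition function $\delta\colon S\to\mathcal{D}((\Sigma\cup\{\epsilon\})\times S)$, where $\mathcal{D}(X)$ is the set of probability functions $P\colon X\to[0,1]$ with $\sum_{x}P(x)=1$. An outgoing path of $s$ of non-zero probability is a sequence $s=r_0,b_1,r_1,\dots,b_m,r_m$ with $r_i\in S$, $b_i\in\Sigma\cup\{\epsilon\}$ and $\delta(r_{i-1})(b_i,r_i)>0$ for all $i$; it contains a symbol in $\Sigma$ if some $b_i\in\Sigma$. For $s_0\in S$ and $n\in\mathbb{N}_0$, $\Omega^n_{s_0}=s_0((\epsilon S)^*\Sigma S)^n$ is the set of alternating sequences $\widetilde{z}=s_0a_1s_1\dots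 a_ms_m$ with $s_i\in S$, $a_i\in\Sigma\cup\{\epsilon\}$, exactly $n$ of the $a_i$ in $\Sigma$, and (if $n\ge1$) $a_m\in\Sigma$. In particular $\Omega^1_{s_0}$ consists of the sequences with $a_1=\dots=a_{m-1}=\epsilon$ and $a_m\in\Sigma$ ($m\ge1$). Its probability function is $P^n_{s_0}(\widetilde{z})=\prod_{i=1}^m\delta(s_{i-1})(a_i,s_i)$. Random variables on $\Omega^n_{s_0}$: $Z$ is the identity; $Y(\widetilde{z})\in\Sigma^n$ is the word of observable symbols of $\widetilde{z}$ (states and $\epsilon$'s removed); $L(\widetilde{z})\in S$ is the last state of $\widetilde{z}$. Thus $P(Z=\widetilde{z}\land Y=\widetilde{y})$ equals $P^n_{s_0}(\widetilde{z})$ if $Y(\widetilde{z})=\widetilde{y}$ and $0$ otherwise, where $s_0$ is the first element of $\widetilde{z}$ and $n=|\widetilde{y}|$. *)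

(* Defs.v *)
From HB Require Import structures.
From mathcomp Require Import all_boot all_order all_algebra.
From mathcomp Require Import all_classical all_reals.

Set Implicit Arguments.
Unset Strict Implicit.
Unset Printing Implicit Defensive.

Import Order.TTheory GRing.Theory Num.Theory.
Local Open Scope classical_set_scope.
Local Open Scope ring_scope.

Record prob_fun (R : realType) (X : finType) := ProbFun {
  prob_val :> X -> R;
  prob_val_itv : forall x, 0 <= prob_val x <= 1;
  prob_val_sum : \sum_x prob_val x = 1 }.

Section Maximum.
Variable R : realType.

Definition is_maximum (A : set R) (m : R) : Prop := A m /\ ubound A m.

(* The value is 0, meaningless, when A has no maximum. *)
Definition maximum (A : set R) : R := xget 0 (is_maximum A).

End Maximum.

(* None : option Sigma stands for the empty symbol epsilon. *)
Definition transition (R : realType) (S Sigma : finType) :=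
  S -> prob_fun R (option Sigma * S)%type.

(* s_0 a_1 s_1 ... a_m s_m is encoded as (s_0, [:: (a_1, s_1); ...; (a_m, s_m)]). *)
Definition altseq (S Sigma : finType) : Type := (S * seq (option Sigma * S))%type.

Section AltSeq.
Variables S Sigma : finType.
Implicit Types z : altseq S Sigma.

(* The list of the (s_{i-1}, (a_i, s_i)); zip drops the last state s_m. *)
Definition steps z : seq (S * (option Sigma * S)) :=
  zip (z.1 :: unzip2 z.2) z.2.

Definition obs z : seq Sigma := pmap fst z.2.

Definition last_state z : S := last z.1 (unzip2 z.2).

Definition ends_observably z : bool :=
  if z.2 is x :: p then isSome (last x p).1 else true.

(* The sequences of s0 ((epsilon S)^* Sigma S)^n: those that contain n
   observable symbols and, unless they are reduced to s0, have a_m in Sigma. *)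
Definition Omega (n : nat) (s0 : S) : set (altseq S Sigma) :=
  [set z | [/\ z.1 = s0, size (obs z) = n & ends_observably z]].

End AltSeq.

Section HMM.
Variables (R : realType) (S Sigma : finType) (delta : transition R S Sigma).

Definition path_prob (z : altseq S Sigma) : R :=
  \prod_(t <- steps z) delta t.1 t.2.

(* P(Z = z /\ Y = y) *)
Definition joint_prob (z : altseq S Sigma) (y : seq Sigma) : R :=
  if obs z == y then path_prob z else 0.

Definition can_observe (s : S) : Prop :=
  exists p : seq (option Sigma * S),
    all (fun t => 0 < delta t.1 t.2) (steps (s, p)) /\
    has (fun x => isSome x.1) p.

Definition joint_probs (a : Sigma) (s0 s : S) : set R :=
  [set joint_prob z [:: a] | z in Omega 1 s0 `&` [set z | last_state z = s]].

Definition most_likely (a : Sigma) (s0 s : S) : R :=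
  maximum (joint_probs a s0 s).

End HMM.

(* Main.v *)
(* Deleting the loop between two visits of the same state does not decrease the
   probability of a path, since the deleted factors are at most 1.  The supremum
   over the paths is therefore a maximum over the finitely many ones whose
   epsilon-part visits no state twice.  Splitting a path at its first symbol
   then gives the recursion. *)
Require Import Defs.
From HB Require Import structures.
From mathcomp Require Import all_boot all_order all_algebra.
From mathcomp Require Import all_classical all_reals.

Set Implicit Arguments.
Unset Strict Implicit.
Unset Printing Implicit Defensive.

Import Order.TTheory GRing.Theory Num.Theory.
Local Open Scope classical_set_scope.
Local Open Scope ring_scope.

Section EpsilonPaths.
Variables (R : realType) (S Sigma : finType) (delta : transition R S Sigma).
Variables (a : Sigma) (s : S).

(* The path x epsilon l_1 epsilon ... epsilon l_k a s. *)
Definition eps_path (x : S) (l : seq S) : altseq S Sigma :=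
  (x, rcons [seq (None, y) | y <- l] (Some a, s)).

Fixpoint eps_weight (x : S) (l : seq S) : R :=
  if l is y :: l' then delta x (None, y) * eps_weight y l'
  else delta x (Some a, s).

Lemma path_prob_cons x t p :
  path_prob delta (x, t :: p) = delta x t * path_prob delta (t.2, p).
Proof. by rewrite /path_prob big_cons. Qed.

Lemma path_prob_eps_path x l : path_prob delta (eps_path x l) = eps_weight x l.
Proof.
elim: l x => [|y l IHl] x; last by rewrite path_prob_cons IHl.
by rewrite /path_prob /steps /= big_seq1.
Qed.

Lemma obs_eps_path x l : obs (eps_path x l) = [:: a].
Proof. by rewrite /obs /=; elim: l. Qed.

Lemma last_state_eps_path x l : last_state (eps_path x l) = s.
Proof. by rewrite /last_state /= /unzip2 map_rcons last_rcons. Qed.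

Lemma Omega1_eps_path x l : Omega 1 x (eps_path x l).
Proof.
split; rewrite ?obs_eps_path //.
by case: l => [|y l] //; rewrite /ends_observably /= last_rcons.
Qed.

Lemma obs_nil_eps (q : seq (option Sigma * S)) :
  pmap fst q = [::] -> q = [seq (None, y) | y <- unzip2 q].
Proof. by elim: q => [|[[b|] y] q IHq] //= /IHq {1}->. Qed.

(** The last symbol of [z] is observable, hence is the only observation [a]; all earlier symbols are
    then epsilon. *)
Lemma Omega1_obsP x z : Omega 1 x z -> last_state z = s -> obs z = [:: a] ->
  exists l, z = eps_path x l.
Proof.
case: z => x' p [/= -> _].
rewrite /obs /last_state /ends_observably /=; case/lastP: p => // q [c y].
have -> : (if rcons q (c, y) is t :: r then isSome (last t r).1 else true)
          = isSome c.
  by case: q => [|t r] //=; rewrite last_rcons.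
case: c => // b _; rewrite /unzip2 map_rcons last_rcons /= => ->.
rewrite -cats1 pmap_cat /= cats1 -[[:: a]]/(rcons [::] a).
move=> /rcons_inj[/obs_nil_eps Dq ->].
by exists (unzip2 q); rewrite /eps_path -Dq cats1.
Qed.

Lemma eps_weight_ge0 x l : 0 <= eps_weight x l.
Proof.
have delta_ge0 y t : 0 <= delta y t by case/andP: (prob_val_itv (delta y) t).
by elim: l x => [|y l IHl] x //=; rewrite mulr_ge0.
Qed.

Lemma joint_probs_eps_weight x l : joint_probs delta a x s (eps_weight x l).
Proof.
exists (eps_path x l).
  by split; [exact: Omega1_eps_path | exact: last_state_eps_path].
by rewrite /joint_prob obs_eps_path eqxx path_prob_eps_path.
Qed.

(* Paths with an observation other than a contribute the value 0. *)
Lemma joint_probs_le x r : joint_probs delta a x s r ->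
  exists l, r <= eps_weight x l.
Proof.
move=> [z [Oz Lz] <-]; rewrite /joint_prob; case: eqP => [Yz|_].
  have [l ->] := Omega1_obsP Oz Lz Yz.
  by exists l; rewrite path_prob_eps_path.
by exists [::]; exact: eps_weight_ge0.
Qed.

Lemma eps_weight_cat_le x p l :
  eps_weight x (p ++ l) <= eps_weight (last x p) l.
Proof.
elim: p x => [|y p IHp] x //=; apply: le_trans (IHp y).
apply: ler_piMl; first exact: eps_weight_ge0.
by case/andP: (prob_val_itv (delta x) (None, y)).
Qed.

Lemma eps_weight_le_uniq x l :
  exists2 l', uniq (x :: l') & eps_weight x l <= eps_weight x l'.
Proof.
elim: l x => [|y l IHl] x; first by exists [::].
have [l' Ul' le_l'] := IHl y.
have le_yl' : eps_weight x (y :: l) <= eps_weight x (y :: l').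
  by rewrite /= ler_wpM2l //; case/andP: (prob_val_itv (delta x) (None, y)).
have [|x_notin] := boolP (x \in y :: l'); last first.
  by exists (y :: l') => //; rewrite cons_uniq x_notin.
(* The loop from [x] through [p1] back to [x] is cut out, leaving [p2]; it avoids [x] because [l']
   came from a repetition-free path. *)
move=> x_in; case/splitPr: x_in Ul' le_yl' => p1 p2 Up le_p.
exists p2; first by move: Up; rewrite cat_uniq => /and3P[].
apply: le_trans le_p _; rewrite -cat_rcons.
by apply: le_trans (eps_weight_cat_le _ _ _) _; rewrite last_rcons.
Qed.

Lemma eps_weight_max x :
  exists l, forall l', eps_weight x l' <= eps_weight x l.
Proof.
have S_gt0 : (0 < #|S|)%N by apply/card_gt0P; exists x.
(* A repetition-free [x :: l] has at most [#|S|] states, so [l] has fewer: these lists form a finite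
   type. *)
pose T := {k : 'I_#|S| & k.-tuple S}.
(* The empty list, showing that [T] is inhabited. *)
pose i0 : T := Tagged (fun k : 'I_#|S| => k.-tuple S)
  (nseq_tuple (Ordinal S_gt0) x).
pose w (i : T) := eps_weight x (tagged i).
case: (arg_maxP w (isT : xpredT i0)) => i _ max_i.
exists (tagged i) => l'; have [l Ul le_l] := eps_weight_le_uniq x l'.
apply: (le_trans le_l).
have l_lt : (size l < #|S|)%N.
  by have := max_card (mem (x :: l)); rewrite (card_uniqP Ul).
exact: (max_i (Tagged (fun k : 'I_#|S| => k.-tuple S)
  (in_tuple l : (Ordinal l_lt).-tuple S)) isT).
Qed.

(** Since a maximum exists, [xget] returns one and not its default 0. *)
Lemma most_likelyP x :
  is_maximum (joint_probs delta a x s) (most_likely delta a x s).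
Proof.
apply: xgetPex; have [l max_l] := eps_weight_max x.
exists (eps_weight x l); split; first exact: joint_probs_eps_weight.
by move=> r /joint_probs_le[l' /le_trans]; apply.
Qed.

Lemma most_likely_ge x l : eps_weight x l <= most_likely delta a x s.
Proof. by apply: (most_likelyP x).2; exact: joint_probs_eps_weight. Qed.

(** The maximum might be realised by a path of value 0 observing another symbol, so an [eps_path] of
    at least that value is taken and maximality gives equality. *)
Lemma most_likely_attained x :
  exists l, most_likely delta a x s = eps_weight x l.
Proof.
have [l le_l] := joint_probs_le (most_likelyP x).1.
by exists l; apply/le_anti; rewrite le_l most_likely_ge.
Qed.

End EpsilonPaths.

(* The first conjunct says that the maxima defining most_likely exist.  The
   inner maximum is over terms that are nonnegative, so the unit 0 is harmless. *)
Theorem proposition4p1 (R : realType) (S Sigma : finType)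
    (delta : transition R S Sigma)
    (Hobs : forall s : S, can_observe delta s) (a : Sigma) :
  (forall s0 s : S,
     is_maximum (joint_probs delta a s0 s) (most_likely delta a s0 s)) /\
  (forall s0 s : S,
     most_likely delta a s0 s =
     Num.max (delta s0 (Some a, s))
       (\big[Num.max/0]_(s' : S)
          (delta s0 (None, s') * most_likely delta a s' s))).
Proof.
split=> s0 s; first exact: most_likelyP.
have delta_ge0 x t : 0 <= delta x t by case/andP: (prob_val_itv (delta x) t).
apply/le_anti/andP; split.
  (* An optimal path either emits [a] at once or first moves to some [s'] by epsilon. *)
  have [[|s' l] ->] /= := most_likely_attained delta a s s0.
    by rewrite le_max lexx.
  rewrite le_max; apply/orP; right; apply: le_trans (le_bigmax _ _ s').
  by rewrite ler_wpM2l ?most_likely_ge.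
rewrite ge_max (most_likely_ge delta a s s0 [::]) /=.
apply: bigmax_le => [|s' _].
  (* The unit 0 of the big maximum must also be bounded. *)
  exact: le_trans (delta_ge0 _ _) (most_likely_ge delta a s s0 [::]).
(* Prefixing an optimal path from [s'] with the epsilon-step from [s0] gives a competitor at
   [s0]. *)
have [l ->] := most_likely_attained delta a s s'.
exact: (most_likely_ge delta a s s0 (s' :: l)).
Qed.
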